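(* Let $k>1$ be an integer, let $\beta\in(1,k)$ and let $\omega>0$ be real numbers such that \[ \beta(1+\omega)\le k . \] Then Bob has a winning strategy in the $(\beta,\omega,k)$-game.
   Context: The $(\beta,\omega,k)$-game is an infinite game between Alice and Bob played on the infinite rooted $k$-ary tree. Bob has a current position, a vertex of the tree, which is initially the root. There is a set $F$ of forbidden vertices, initially empty, and vertices never leave $F$. The players alternate, and Alice moves first. On her move, Alice adds to $F$ some set (possibly infinite) of vertices in the subtree rooted at Bob's current position $v$. She may not forbid $v$ itself. Her move is subject to a weight restriction. A vertex of this subtree lying $d$ levels below $v$ has weight $\beta^{-d}$, measured in the current subtree. The total weight of the vertices newly forbidden in that move must not exceed $\omega$. On his move, Bob moves from his current position to one of its $k$ children. Bob loses if he ever moves into a forbidden vertex. Bob wins if he never enters a forbidden vertex, so that he follows an infinite branch forever. *)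

(* Defs.v *)
From HB Require Import structures.
From mathcomp Require Import all_boot all_order all_algebra.
From mathcomp Require Import all_classical all_reals all_analysis.

Set Implicit Arguments.
Unset Strict Implicit.
Unset Printing Implicit Defensive.

Import Order.TTheory GRing.Theory Num.Theory.
Local Open Scope classical_set_scope.
Local Open Scope ring_scope.

(* A vertex of the infinite rooted k-ary tree is the word of child indices read
   along the path from the root; u lies in the subtree of v iff prefix v u. *)
Definition vertex (k : nat) : Type := seq 'I_k.

Section Game.
Variables (R : realType) (beta omega : R) (k : nat).

Definition subtree (v : vertex k) : set (vertex k) :=
  [set u : seq 'I_k | prefix v u].

Definition depth_below (v u : vertex k) : nat := (size u - size v)%N.

(* The sum of a possibly infinite family, valued in the extended reals. *)
Definition weight (v : vertex k) (S : set (vertex k)) : \bar R :=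
  (\esum_(u in S) (beta ^- depth_below v u)%:E)%E.

(* A play: A n is the set Alice adds in round n, b n the child Bob then
   moves to. *)
Definition position (b : nat -> 'I_k) (n : nat) : vertex k := mkseq b n.

Definition forbidden (A : nat -> set (vertex k)) (n : nat) : set (vertex k) :=
  \bigcup_(i in [set i | (i < n)%N]) A i.

(* Only the vertices of M outside F are newly forbidden, hence weighed. *)
Definition alice_legal (v : vertex k) (F M : set (vertex k)) : Prop :=
  [/\ M `<=` subtree v, ~ M v & (weight v (M `\` F) <= omega%:E)%E].

Definition alice_plays_legally (A : nat -> set (vertex k)) (b : nat -> 'I_k) :
  Prop := forall n, alice_legal (position b n) (forbidden A n) (A n).

(* A strategy sees the whole history: the list of Alice's moves so far,
   including the one just made, and Bob's position, which records all of his
   own earlier moves. *)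
Definition bob_strategy : Type := seq (set (vertex k)) -> vertex k -> 'I_k.

Definition follows (s : bob_strategy) (A : nat -> set (vertex k))
    (b : nat -> 'I_k) : Prop :=
  forall n, b n = s (mkseq A n.+1) (position b n).

(* Bob's (n+1)-st move takes him to position b n.+1, after Alice has made the
   moves A 0, ..., A n. *)
Definition bob_wins (A : nat -> set (vertex k)) (b : nat -> 'I_k) : Prop :=
  forall n, ~ forbidden A n.+1 (position b n.+1).

(* Quantifying over infinite plays only loses nothing: a play that Bob loses in
   finitely many rounds extends to an infinite one, Alice adding nothing. *)
Definition bob_winning_strategy (s : bob_strategy) : Prop :=
  forall (A : nat -> set (vertex k)) (b : nat -> 'I_k),
    alice_plays_legally A b -> follows s A b -> bob_wins A b.

Definition bob_has_winning_strategy : Prop :=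
  exists s : bob_strategy, bob_winning_strategy s.

End Game.

(* Main.v *)
Require Import Defs.
From mathcomp Require Import all_boot all_order all_algebra.
From mathcomp Require Import all_classical all_reals all_analysis.
Import Order.TTheory GRing.Theory Num.Theory.
Local Open Scope ring_scope.

(** Bob keeps the weight of the forbidden part of his current subtree strictly
    below [1], which in particular keeps his own vertex, of weight [1], out of
    it.  Alice raises this weight to less than [1 + omega]; seen from the [k]
    children the weights are multiplied by [beta], so their total is less than
    [beta * (1 + omega) <= k] and some child carries weight less than [1]. *)

Local Open Scope classical_set_scope.

Section Weight.
Variables (R : realType) (beta : R) (k : nat).
Hypothesis beta_gt0 : 0 < beta.
Implicit Types (v : vertex k) (i : 'I_k) (S T : set (vertex k)).

Lemma vertex_weight_ge0 v (u : vertex k) :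
  (0 <= (beta ^- depth_below v u)%:E)%E.
Proof. by rewrite lee_fin invr_ge0 exprn_ge0 // ltW. Qed.

(** Below the child, [u] is strictly longer than [v], so the truncated subtraction in [depth_below]
    really drops by one. *)
Lemma vertex_weight_rcons v i (u : vertex k) : subtree (rcons v i) u ->
  beta ^- depth_below (rcons v i) u = beta * beta ^- depth_below v u.
Proof.
rewrite /subtree /= => /size_prefix; rewrite /depth_below size_rcons => vu.
by rewrite -(subnSK vu) exprS invfM mulrA mulfV ?mul1r ?gt_eqF.
Qed.

Lemma weightID v T S :
  weight beta v S = (weight beta v (S `&` T) + weight beta v (S `\` T))%E.
Proof. by rewrite /weight (esumID T) // => u _; exact: vertex_weight_ge0. Qed.

Lemma weight_ge1 v S : S v -> (1 <= weight beta v S)%E.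
Proof.
move=> Sv; apply: esum_ge; exists [set v].
  by split=> [|_ ->]; [exact: finite_set1|].
by rewrite fsbig_set1 /depth_below subnn expr0 invr1.
Qed.

(** Every finite partial sum scales exactly by [beta]; the upper bound then passes to the
    supremum. *)
Lemma weight_rcons v i S : S `<=` subtree (rcons v i) ->
  (weight beta (rcons v i) S <= beta%:E * weight beta v S)%E.
Proof.
move=> SI; apply: ge_ereal_sup => /= _ [X [finX XS]] <-.
rewrite [leLHS](_ : _ = (beta%:E * \sum_(u \in X) (beta ^- depth_below v u)%:E)%E).
  rewrite lee_pmul2l ?lte_fin //; apply: ereal_sup_ubound.
  by exists X.
rewrite ge0_mule_fsumr; last by move=> u; exact: vertex_weight_ge0.
by apply: eq_fsbigr => u /[!inE] /XS /SI /vertex_weight_rcons ->.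
Qed.

(** The subtrees of distinct children are disjoint, so after exchanging the sums each vertex is
    counted at most once. *)
Lemma weight_children v S :
  (\sum_i weight beta v (S `&` subtree (rcons v i)) <= weight beta v S)%E.
Proof.
under eq_bigr => i _ do rewrite /weight esum_mkcondr.
rewrite -esum_sum; last by move=> u i _ _; case: ifP => // _; exact: vertex_weight_ge0.
apply: le_esum => u _.
have [[i ui]|none] := pselect (exists i, subtree (rcons v i) u); last first.
  rewrite big1 ?vertex_weight_ge0 // => i _.
  by rewrite memNset // => ui; apply: none; exists i.
rewrite (bigD1 i) //= mem_set // big1 ?adde0 // => j ji.
rewrite memNset //; apply: contra_not (negP ji); move: ui; rewrite /subtree /=.
rewrite !prefixE !size_rcons => /eqP -> /eqP.
by case/rcons_inj => ->.
Qed.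

(** Pigeonhole: [k] children of weight at least 1 would force the total up to [k]. *)
Lemma exists_light_child v S : (beta%:E * weight beta v S < k%:R%:E)%E ->
  exists i, (weight beta (rcons v i) (S `&` subtree (rcons v i)) < 1)%E.
Proof.
move=> small; apply/not_existsP => heavy; move: small; apply/negP.
rewrite -leNgt.
apply: (@le_trans _ _
  (\sum_i beta%:E * weight beta v (S `&` subtree (rcons v i)))%E).
  rewrite -[X in X%:R](card_ord k) -sum1_card natr_sum -sumEFin.
  apply: lee_sum => i _.
  apply: le_trans (weight_rcons _ _ _ (@subIsetr _ _ _)).
  by rewrite leNgt; apply/negP; exact: heavy.
rewrite -ge0_sume_distrr; last first.
  by move=> i _; apply: esum_ge0 => u _; exact: vertex_weight_ge0.
by rewrite lee_pmul2l ?lte_fin // weight_children.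
Qed.

End Weight.

Lemma forbiddenS (k : nat) (A : nat -> set (vertex k)) n :
  forbidden A n.+1 = forbidden A n `|` A n.
Proof. by rewrite /forbidden !bigcup_mkord big_ord_recr. Qed.

(** The list of moves is read as a sequence so that [forbidden] applies to it; [i0] is the answer
    when no child is light. *)
Definition light_child_strategy {R : realType} (beta : R) {k : nat} (i0 : 'I_k) :
    bob_strategy k := fun moves v =>
  let F := forbidden (nth set0 moves) (size moves) in
  xget i0 [set i | (weight beta (rcons v i) (F `&` subtree (rcons v i)) < 1)%E].

Lemma forbidden_mkseq (k : nat) (A : nat -> set (vertex k)) n :
  forbidden (nth set0 (mkseq A n)) (size (mkseq A n)) = forbidden A n.
Proof.
by rewrite size_mkseq; apply: eq_bigcupr => i /= ltin; rewrite nth_mkseq.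
Qed.

(** The weight is taken after Bob's arrival and before Alice's move [A n]. *)
Lemma light_child_strategy_invariant (R : realType) (k : nat) (beta omega : R)
    (i0 : 'I_k) (A : nat -> set (vertex k)) (b : nat -> 'I_k) :
  0 < beta -> beta * (1 + omega) <= k%:R ->
  alice_plays_legally beta omega A b ->
  follows (light_child_strategy beta i0) A b ->
  forall n, (weight beta (position b n)
               (forbidden A n `&` subtree (position b n)) < 1)%E.
Proof.
move=> beta0 h legal fol; elim=> [|n IHn].
  by rewrite /forbidden bigcup_mkord big_ord0 set0I /weight esum_set0 lte_fin.
set v := position b n in IHn *.
have posS : position b n.+1 = rcons v (b n) by rewrite /position mkseqS.
have [AnS _ Anw] := legal n; rewrite -/v in AnS Anw.
set S := forbidden A n.+1.
have [i lighti] : exists i,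
    (weight beta (rcons v i) (S `&` subtree (rcons v i)) < 1)%E.
  have Ssub i : S `&` subtree (rcons v i)
      = (S `&` subtree v) `&` subtree (rcons v i).
    rewrite -setIA; congr (_ `&` _); apply/esym/setIidPr => u.
    exact/prefix_trans/prefix_rcons.
  under eq_exists => i do rewrite Ssub.
  apply: exists_light_child => //.
  apply: (@lt_le_trans _ _ (beta * (1 + omega))%:E); last by rewrite lee_fin.
  (* Splitting along [forbidden A n] leaves an old part, bounded by the induction hypothesis, and a
     new part, exactly the set weighed by Alice's legality condition. *)
  have oldE : S `&` subtree v `&` forbidden A n = forbidden A n `&` subtree v.
    rewrite /S forbiddenS; apply/seteqP; split=> u /=; first by case=> -[].
    by case; do !split=> //; left.
  have newE : (S `&` subtree v) `\` forbidden A n = A n `\` forbidden A n.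
    rewrite /S forbiddenS; apply/seteqP; split=> u /=; first by case=> -[[]].
    by case=> Au nFu; do !split=> //; [right|exact: AnS].
  rewrite EFinM lte_pmul2l ?lte_fin // (weightID _ _ _ beta0 _ (forbidden A n)).
  (* Strictness comes from the old part and survives adding [omega], which is finite. *)
  rewrite oldE newE EFinD; apply: le_lt_trans (leeD2l _ Anw) _.
  by rewrite lteD2rE.
rewrite posS fol /light_child_strategy forbidden_mkseq -/v -/S.
(* The default case is excluded by the light child [i]. *)
by case: xgetP => [j _ //|/(_ i)]; case.
Qed.

Theorem theorem1 (R : realType) (k : nat) (beta omega : R)
  (hk : (1 < k)%N) (hbeta1 : 1 < beta) (hbetak : beta < k%:R)
  (homega : 0 < omega) (h : beta * (1 + omega) <= k%:R) :
  bob_has_winning_strategy beta omega k.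
Proof.
have beta0 : 0 < beta by exact: lt_trans hbeta1.
exists (light_child_strategy beta (Ordinal hk)) => A b legal fol n Fpos.
have := light_child_strategy_invariant _ _ _ _ _ _ _ beta0 h legal fol n.+1.
rewrite ltNge => /negP; apply; apply: weight_ge1.
by split=> //; exact: prefix_refl.
Qed.
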